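(* Let $\mathrm{CP}_n$ denote the binary caterpillar tree on $2n+1$ nodes. Then for every integer $m\ge0$, $$\lim_{n\to\infty}\mathbf P\big[|\mathrm{CP}_{n,\mathfrak S}|=m\big]=\int_0^1\left(m(x-x^2)^m+\frac{x(x-x^2)^m}{1-x+x^2}\right)dx=\frac{\pi}{3\sqrt3}+\frac{m}{(m+1)\binom{2m+1}{m}}-\sum_{j=0}^{m-1}\frac{1}{(j+1)\binom{2j+2}{j+1}},$$ these limits form a probability distribution on the non-negative integers, and $|\mathrm{CP}_{n,\mathfrak S}|$ converges in distribution to it as $n\to\infty$.
   Context: $\mathrm{CP}_n$ is the rooted binary tree (every non-leaf has exactly two children) on $2n+1$ nodes in which every node is either a leaf (a vertex without children) or has at least one child which is a leaf. Equivalently, $\mathrm{CP}_0$ is a single vertex and $\mathrm{CP}_{n+1}$ is a root with two children, one being a leaf and the other being the root of a copy of $\mathrm{CP}_n$. Cutting procedure. For a finite rooted tree $\mathcal T$, the root is the unique source and the leaves are the targets. Put $\mathcal T^0=\mathcal T$. As long as $\mathcal T^{i-1}$ is nonempty, choose a vertex of it uniformly at random (independently of the past), delete it with its incident edges, and discard all connected components not containing the root; the result is $\mathcal T^i$ (the empty graph if the root is deleted). $\mathcal T_{\mathfrak S}$ denotes the random graph $\mathcal T^i$ at the first $i$ for which $\mathcal T^i$ contains no leaf of the original tree $\mathcal T$; $\mathrm{CP}_{n,\mathfrak S}$ is this graph for $\mathcal T=\mathrm{CP}_n$, and $|\cdot|$ is the number of vertices. *)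

(* Defs.v *)
From HB Require Import structures.
From mathcomp Require Import all_boot all_order all_algebra.
From mathcomp Require Import all_classical all_reals all_analysis.
Set Implicit Arguments.
Unset Strict Implicit.
Unset Printing Implicit Defensive.
Import Order.TTheory GRing.Theory Num.Theory.
Import numFieldNormedType.Exports.
Local Open Scope classical_set_scope.
Local Open Scope ring_scope.

(* Finite rooted graphs, with edges oriented from parent to child. *)
Record rooted_graph := RootedGraph {
  vertex :> finType;
  child : rel vertex;
  tree_root : vertex }.

Definition one_vertex : rooted_graph :=
  @RootedGraph unit (fun _ _ => false) tt.

(* A new root [None] with two children: a leaf [Some None], and the root of a
   copy of [T] on the vertices [Some (Some _)]. *)
Definition add_root_leaf (T : rooted_graph) : rooted_graph :=
  @RootedGraph (option (option T))
    (fun u v => match u, v with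
                | None, Some None => true
                | None, Some (Some y) => y == tree_root T
                | Some (Some x), Some (Some y) => child x y
                | _, _ => false
                end)
    None.

Definition caterpillar (n : nat) : rooted_graph :=
  iter n add_root_leaf one_vertex.

Section Cutting.
Variable T : rooted_graph.
Implicit Types (S : {set T}) (h : seq T).

Definition leaf (x : T) : bool := [forall y, ~~ child x y].

Definition adjacent_in S : rel T :=
  fun x y => [&& x \in S, y \in S & child x y || child y x].

(* The component of the root after the deletion of [v] from the graph induced
   on [S]; it is empty when [v] is the root. *)
Definition cut_vertex S (v : T) : {set T} :=
  [set u in S :\ v | (tree_root T \in S :\ v) &&
                     connect (adjacent_in (S :\ v)) (tree_root T) u].

(* The graph left after deleting the vertices of [h] one after the other. *)
Definition remaining h : {set T} := foldl cut_vertex [set: T]%SET h.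

Definition leafless S : bool := [forall x in S, ~~ leaf x].

Section Process.
Context d (Omega : measurableType d).
Variable c : nat -> Omega -> T.

Definition history (i : nat) (w : Omega) : seq T := mkseq (c ^~ w) i.

Definition tree_at (i : nat) (w : Omega) : {set T} := remaining (history i w).

(* The first [i] such that [tree_at i w] contains no leaf of [T]. It exists
   almost surely for a cutting process; the value is 0 where it does not. *)
Definition separation_time (w : Omega) : nat :=
  xget 0%N [set i | leafless (tree_at i w) /\
                    forall j, (j < i)%N -> ~~ leafless (tree_at j w)].

Definition separated_graph (w : Omega) : {set T} :=
  tree_at (separation_time w) w.

End Process.

(* [chosen i] is the vertex deleted at step [i + 1]. The third field says that,
   given the choices made so far, the next one is uniform on the vertices of
   the current tree. Nothing is required once the tree is empty: [cut_vertex]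
   maps the empty graph to itself. *)
Record cutting_process d (Omega : measurableType d) (R : realType)
    (P : probability Omega R) := CuttingProcess {
  chosen : nat -> Omega -> T;
  chosen_measurable : forall i v, measurable (chosen i @^-1` [set v]);
  chosen_uniform : forall h v, v \in remaining h ->
    P [set w | history chosen (size h) w = h /\ chosen (size h) w = v] =
    (P [set w | history chosen (size h) w = h] *
     (#|remaining h|%:R^-1)%:E)%E }.

End Cutting.

Definition cvg_in_distribution (R : realType) (d : nat -> measure_display)
    (Omega : forall n, measurableType (d n))
    (P : forall n, probability (Omega n) R)
    (X : forall n, Omega n -> nat) (mu : probability nat R) : Prop :=
  forall f : nat -> R, continuous f -> bounded_fun f ->
    ('E_(P n)[fun w => f (X n w)])%E @[n --> \oo] --> (\int[mu]_k (f k)%:E)%E.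

Lemma card_caterpillar n : #|caterpillar n| = n.*2.+1.
Proof. by elim: n => [|n IHn]; rewrite ?card_unit//= !card_option IHn. Qed.

(* Every rooted graph has a cutting process, here on the sample space [nat]:
   the first [#|T|] choices are coded by a natural number, and no choice matters
   once the tree is empty. *)
Section Existence.
Variables (T : rooted_graph) (R : realType).
Implicit Types (h : seq T) (v : T).
Let N := #|T|.

Let kn h v : R := if remaining h == finset.set0 then (v == tree_root T)%:R
  else (v \in remaining h)%:R / #|remaining h|%:R.

Let kn_ge0 h v : 0 <= kn h v.
Proof. by rewrite /kn; case: ifP => _; rewrite ?divr_ge0 ?ler0n. Qed.

Let sum_kn h : \sum_v kn h v = 1.
Proof.
rewrite /kn; case: (boolP (remaining h == finset.set0)) => h0.
  by rewrite (bigD1 (tree_root T))//= eqxx big1 ?addr0// => v /negbTE ->.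
rewrite -mulr_suml -natr_sum.
have -> : (\sum_v (v \in remaining h) = #|remaining h|)%N.
  by rewrite -sum1_card [RHS]big_mkcond; apply: eq_bigr => v _; case: ifP.
rewrite divff//.
by rewrite pnatr_eq0 cards_eq0.
Qed.

Let wt h : R := \prod_(i < size h) kn (take i h) (nth (tree_root T) h i).

Let wt_ge0 h : 0 <= wt h. Proof. exact: prodr_ge0. Qed.

Let wt_rcons h v : wt (rcons h v) = wt h * kn h v.
Proof.
rewrite /wt size_rcons big_ord_recr /= nth_rcons ltnn eqxx.
rewrite -cats1 take_size_cat//; congr (_ * _); apply: eq_bigr => i _.
by rewrite take_cat nth_cat ltn_ord.
Qed.

Let remaining_rcons h v : remaining (rcons h v) = cut_vertex (remaining h) v.
Proof. by rewrite /remaining -cats1 foldl_cat. Qed.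

Let cut_sub (S : {set T}) v : cut_vertex S v \subset (S :\ v)%SET.
Proof. by apply/fintype.subsetP => u; rewrite inE => /andP[]. Qed.

Let wt_neq0 h : wt h != 0 ->
  (remaining h == finset.set0) || (#|remaining h| + size h <= N)%N.
Proof.
elim/last_ind: h => [_|h v IHh]; first by rewrite addn0 max_card orbT.
rewrite wt_rcons mulf_eq0 negb_or size_rcons remaining_rcons => /andP[/IHh].
rewrite /kn; have [-> _ _|hN0 /= IH] := eqVneq (remaining h) finset.set0.
  by rewrite -finset.subset0 (fintype.subset_trans (cut_sub _ _))//
     finset.set0D fintype.subxx.
case: (boolP (v \in _)) => [vh _|_]; last by rewrite mul0r eqxx.
apply/orP; right; apply: leq_trans IH; rewrite addnS -addSn leq_add2r.
by rewrite (cardsD1 v (remaining h)) vh add1n ltnS subset_leq_card.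
Qed.

Let sum_wt k h : (size h + k)%N = N ->
  \sum_(t : N.-tuple T) wt t * (take (size h) t == h)%:R = wt h.
Proof.
elim: k h => [|k IHk] h hk.
  have sh : size h == N by rewrite -hk addn0.
  rewrite (bigD1 (Tuple sh))//= take_size eqxx mulr1 big1 ?addr0// => t.
  rewrite -val_eqE/= take_oversize ?size_tuple ?(eqP sh)// => /negbTE ->.
  by rewrite mulr0.
have <- : \sum_v wt (rcons h v) = wt h.
  by under eq_bigr do rewrite wt_rcons; rewrite -mulr_sumr sum_kn mulr1.
under [RHS]eq_bigr do rewrite -IHk ?size_rcons ?addSnnS//.
rewrite exchange_big/=; apply: eq_bigr => t _.
rewrite -mulr_sumr; congr (_ * _).
have ht : (size h < size t)%N by rewrite size_tuple -hk -addSnnS leq_addr.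
rewrite (take_nth (tree_root T) ht).
rewrite (bigD1 (nth (tree_root T) t (size h)))//= eqseq_rcons.
rewrite eqxx andbT big1 ?addr0// => v vt.
by rewrite eqseq_rcons [_ == v]eq_sym (negbTE vt) andbF.
Qed.

Let I := N.-tuple T.
Let i0 : I := nseq_tuple N (tree_root T).
Let tup (k : nat) : I := nth i0 (enum {: I}) k.

Let P0 : {measure set nat -> \bar R} :=
  msum (fun k => mscale (NngNum (wt_ge0 (tup k))) (dirac k)
                 : {measure set nat -> \bar R}) #|{: I}|.

Let P0E (A : set nat) (p : pred I) : (forall k, A k <-> p (tup k)) ->
  P0 A = (\sum_(t : I) wt t * (p t)%:R)%:E.
Proof.
move=> Ap; rewrite /P0/= /msum/=.
under eq_bigr do rewrite /mscale/= diracE -EFinM.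
rewrite sumEFin; congr (_%:E).
rewrite -[RHS]big_enum /= (big_nth i0) big_mkord -cardE.
apply: eq_bigr => k _; congr (_ * _%:R); congr nat_of_bool.
by apply/idP/idP; rewrite in_setE => /Ap.
Qed.

Let P0_setT : P0 setT = 1%E.
Proof.
rewrite (P0E (p := xpredT))//; have := @sum_wt N [::] erefl.
rewrite /wt big_ord0 => {3}<-; congr EFin; apply: eq_bigr => t _.
by rewrite take0 eqxx.
Qed.

Let remaining_cat h h' : remaining (h ++ h') \subset remaining h.
Proof.
elim/last_ind: h' => [|h' v IH]; first by rewrite cats0.
rewrite -rcons_cat remaining_rcons.
apply: fintype.subset_trans (cut_sub _ _) _.
exact: fintype.subset_trans (subD1set _ _) IH.
Qed.

Let mkE (t : I) k : (k <= N)%N -> mkseq (nth (tree_root T) t) k = take k t.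
Proof.
move=> kN; rewrite -[in RHS](mkseq_nth (tree_root T) t) /mkseq -map_take.
by rewrite take_iota size_tuple (minn_idPl kN).
Qed.

Let wt_eq0 h v (t : I) : v \in remaining h -> (N <= size h)%N ->
  mkseq (nth (tree_root T) t) (size h) = h -> wt t = 0.
Proof.
move=> vh hN th; apply/eqP; apply: contraLR vh => /wt_neq0.
rewrite size_tuple -[X in (_ <= X)%N]add0n leq_add2r leqn0 cards_eq0 orbb => t0.
have -> : h = take N h ++ drop N h by rewrite cat_take_drop.
apply/negP => /(fintype.subsetP (remaining_cat _ _)).
suff -> : take N h = t by rewrite (eqP t0) inE.
rewrite -th /mkseq -map_take take_iota (minn_idPl hN).
by rewrite -/(mkseq _ _) mkE// take_oversize// size_tuple.
Qed.

Lemma cutting_process_exists :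
  exists P : probability nat R, inhabited (cutting_process T P).
Proof.
pose isP := Measure_isProbability.Build _ _ _ P0 P0_setT.
pose P : probability nat R := HB.pack (P0 : set nat -> \bar R) (Measure.on P0) isP.
exists P; constructor.
pose c i k := nth (tree_root T) (tup k) i.
have mc i v : measurable (c i @^-1` [set v]) by [].
apply: (CuttingProcess mc) => h v vh.
rewrite (P0E (p := fun t => (mkseq (nth (tree_root T) t) (size h) == h) &&
    (nth (tree_root T) t (size h) == v))); last first.
  move=> k; split=> [[H1 H2]|/andP[/eqP H1 /eqP H2]//].
  by apply/andP; split; apply/eqP.
rewrite (P0E (p := fun t => mkseq (nth (tree_root T) t) (size h) == h));
  last first.
  by move=> k; split=> /eqP.
rewrite -EFinM; congr EFin; have [hN|hN] := ltnP (size h) N; last first.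
  rewrite !big1 ?mul0r// => t _; case: (eqVneq (mkseq _ _) h) => /= [ht|_];
    by rewrite ?mulr0// (wt_eq0 vh hN ht) mul0r.
under eq_bigr => t _.
  rewrite (mkE _ (ltnW hN)) -eqseq_rcons -take_nth ?size_tuple//.
  rewrite -(size_rcons h v); over.
under [X in _ = X * _]eq_bigr => t _ do rewrite (mkE _ (ltnW hN)).
rewrite (@sum_wt (N - (size h).+1)) ?size_rcons ?subnKC//.
rewrite (@sum_wt (N - size h)) ?(subnKC (ltnW hN))//.
rewrite wt_rcons /kn ifF ?vh ?mul1r//.
by apply/eqP => h0; rewrite h0 inE in vh.
Qed.
End Existence.

(* Main.v *)
Require Import Defs.
From HB Require Import structures.
From mathcomp Require Import all_boot all_order all_algebra.
From mathcomp Require Import all_classical all_reals all_analysis.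
From mathcomp Require Import ring lra zify.
Set Implicit Arguments.
Unset Strict Implicit.
Unset Printing Implicit Defensive.
Import Order.TTheory GRing.Theory Num.Theory.
Import numFieldNormedType.Exports.
Local Open Scope classical_set_scope.
Local Open Scope ring_scope.

(** The process visits a given subtree [A] of a tree with probability
    [1 / 'C(a + f, a)], where [a] is the number of vertices of [A] and [f] the
    number of vertices just below it: among these [a + f] vertices, those below [A]
    have to be deleted first.  [hit_harmonic] checks that this expression satisfies
    the first-step equation of the process.

    In a caterpillar the leafless subtrees are the initial segments of the spine.
    The one with [k <= n] vertices has [k + 1] vertices just below it, so it is
    visited with probability [q k = 1 / 'C(2 * k + 1, k)].  Once leafless, the tree
    only passes to shorter segments, each step being uniform, so the segment of
    size [m] is the first leafless tree with probability
    [q m - \sum_(m < k <= n) q k / k].  This is [final_size_law]; its derivation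
    from the first-step equation is [optional_stopping], where the unknown
    probability space enters only through the law of the next deletion.

    With [u = x - x ^+ 2], the Beta integral gives
    [q m = (m + 1) * \int u ^+ m], and the limit law is [m * b m + t m], where [b m] is
    the integral over the unit interval of [u ^+ m] and [t m] that of
    [x * u ^+ m / (1 - u)].  The recurrence [t m - t (m + 1) = b m / 2] and the value
    of [t 0], an arctangent, give the closed form.  The same recurrences show that
    the law for finite [n] exceeds the limit law at every [m <= n] by the same
    amount [b n - t n], and that the masses of the limit law at [0], ..., [n] add up
    to [1 - (n + 1) * (b n - t n)].  As [b n - t n] is [O(1 / n ^+ 2)], the point masses
    converge and the limits add up to one, which on the natural numbers implies
    convergence in distribution ([cvg_in_distribution_pmf]). *)

(** * Visits to a subtree during the cutting of a rooted tree *)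

Section RootedTree.
Variable T : rooted_graph.
Implicit Types (S A : {set T}) (u v x y : T).
Local Notation child := (@child T).

Definition is_tree : Prop :=
  [/\ forall x, connect child (tree_root T) x,
      forall x y z, child x z -> child y z -> x = y :> T &
      forall x, ~~ child x (tree_root T)].

Definition parent_closed S : Prop :=
  forall x y, child x y -> y \in S -> x \in S.

(** The vertices of [S] that lie just below [A], with the root of [S] counted
    when [A] is empty.  For parent-closed [A] and [S] with [A] included in [S], the
    process started from [S] visits [A] exactly when all of them are deleted before
    any vertex of [A]. *)
Definition frontier A S : {set T} :=
  [set y in S :\: A | [forall x, child x y ==> (x \in A)]].

Lemma parent_closed_connect S x y :
  parent_closed S -> connect child x y -> y \in S -> x \in S.
Proof.
move=> clS /connectP[p + ->]; elim: p x => //= z p IHp x /andP[xz zp] yS.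
exact: clS xz (IHp _ zp yS).
Qed.

Hypothesis Ttree : is_tree.

Lemma connect_parent u v x :
  connect child v u -> v != u -> child x u -> connect child v x.
Proof.
case: Ttree => _ uniq_parent _ /connectP[p + ->].
case/lastP: p => [_ /eqP//|p y]; rewrite rcons_path last_rcons => /andP[vp py] _.
by move=> /uniq_parent /(_ py) ->; apply/connectP; exists p.
Qed.

Lemma connect_root v : connect child v (tree_root T) -> v = tree_root T.
Proof.
case: Ttree => _ _ root_orphan /connectP[p].
case/lastP: p => [//|p y]; rewrite rcons_path last_rcons => /andP[_ + yE].
by rewrite -yE (negbTE (root_orphan _)).
Qed.

(** In a tree the deletion of [v] disconnects from the root exactly the
    descendants of [v]: the path from the root to any other vertex avoids [v],
    and an edge can leave the set of descendants only through [v]. *)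
Lemma cut_vertexE S v : parent_closed S ->
  cut_vertex S v = [set u in S | ~~ connect child v u]%SET.
Proof.
move=> clS; case: (Ttree) => rooted uniq_parent _.
apply/setP => u; rewrite !inE; apply/idP/idP.
  case/andP=> /andP[_ ->] /andP[/andP[rootv _]] /= ru.
  (* Adjacency in the remaining graph preserves not being a descendant of v. *)
  have cl : fingraph.closed (adjacent_in (S :\ v)) [pred w | ~~ connect child v w].
    have step x y : x != v -> y != v -> child x y ->
        connect child v x = connect child v y.
      move=> _ yv xy; apply/idP/idP => [vx|vy].
        exact: connect_trans vx (connect1 xy).
      by apply: connect_parent vy _ xy; rewrite eq_sym.
    move=> x y; rewrite /adjacent_in !inE => /and3P[/andP[xv _] /andP[yv _]].
    by case/orP=> xy; [rewrite (step _ _ xv yv xy)|rewrite -(step _ _ yv xv xy)].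
  have := fingraph.closed_connect cl ru; rewrite !inE => <-.
  by apply: contra rootv => /connect_root ->.
case/andP=> uS vu; have neqv x : connect child x u -> x != v.
  by apply: contraTneq => ->.
rewrite uS (neqv u) ?connect0 ?neqv//=.
rewrite (parent_closed_connect clS (rooted u) uS) /=.
have /connectP[p + uE] := rooted u; elim: p (tree_root T) uE => [|z p IHp] x /=.
  by move=> -> _; exact: connect0.
move=> uE /andP[xz zp].
have zu : connect child z u by apply/connectP; exists p.
have xu : connect child x u by apply: connect_trans (connect1 xz) zu.
apply: connect_trans (connect1 _) (IHp _ uE zp).
rewrite /adjacent_in !inE !neqv//= xz andbT.
by rewrite !(parent_closed_connect clS _ uS).
Qed.

Lemma parent_closed_cut S v : parent_closed S -> parent_closed (cut_vertex S v).
Proof.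
move=> clS x y xy; rewrite cut_vertexE// !inE => /andP[yS vy].
rewrite (clS _ _ xy yS); apply: contra vy => /connect_trans; apply.
exact: connect1.
Qed.

Lemma cut_vertex_lt S v : v \in S -> (#|cut_vertex S v| < #|S|)%N.
Proof.
move=> vS; rewrite [ltnRHS](cardsD1 v) vS ltnS subset_leq_card//.
by apply/fintype.subsetP => u; rewrite inE => /andP[].
Qed.

(** Follow the path from the root to a vertex of [S] outside [A]: the first
    vertex of it that leaves [A] lies in the frontier. *)
Lemma frontier_neq0 S A : parent_closed A -> parent_closed S ->
  A \proper S -> frontier A S != finset.set0.
Proof.
move=> clA clS /fintype.properP[AS [u uS uA]].
apply: contra uA => /eqP fr0; case: (Ttree) => rooted uniq_parent root_orphan.
have {}fr0 y : y \in S -> (forall x, child x y -> x \in A) -> y \in A.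
  move=> yS par; have := finset.in_set0 y; rewrite -fr0 !inE yS andbT.
  by move/negbT; rewrite negb_and negbK => /orP[//|/forallP[x]]; apply/implyP/par.
have /connectP[p + uE] := rooted u.
elim/last_ind: p u uS uE => [|p y IHp] u uS uE.
  by move=> _; apply: fr0 => // x; rewrite uE (negbTE (root_orphan x)).
rewrite rcons_path => /andP[rp py]; rewrite last_rcons in uE.
apply: fr0 => // x; rewrite uE => /uniq_parent /(_ py) ->.
by apply: IHp => //; apply: clS py _; rewrite -uE.
Qed.

(** No frontier vertex other than [v] is below [v], since its parent would then
    lie in [A] below [v], which would put [v] in [A]. *)
Lemma frontier_cut A S v : parent_closed A -> parent_closed S ->
  v \notin A -> frontier A (cut_vertex S v) = frontier A S :\ v.
Proof.
move=> clA clS vA; apply/setP => y; rewrite cut_vertexE// !inE.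
have [->|yv] /= := eqVneq y v; first by rewrite connect0 andbF /= andbF.
have [yS|] := boolP (y \in S); last by rewrite !andbF.
case: (boolP [forall x, _]) => [/forallP par|]; last by rewrite !andbF.
rewrite !andbT; case: (boolP (connect _ _ _)) => [vy|_]; last by rewrite andbT.
have /connectP[p] := vy; case/lastP: p => [_ yE|p z].
  by rewrite yE eqxx in yv.
rewrite rcons_path last_rcons => /andP[vp pz] yE.
case/negP: vA; apply: parent_closed_connect clA _ (_ : last v p \in A).
  by apply/connectP; exists p.
by apply: (implyP (par _)); rewrite yE.
Qed.

Lemma sub_cut A S v : parent_closed A -> parent_closed S -> A \subset S ->
  (A \subset cut_vertex S v) = (v \notin A).
Proof.
move=> clA clS AS; apply/idP/idP => [AC|vA].
  apply/negP => /(fintype.subsetP AC).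
  by rewrite cut_vertexE// inE connect0 andbF.
apply/fintype.subsetP => u uA; rewrite cut_vertexE// inE (fintype.subsetP AS)//=.
by apply: contra vA => vu; apply: parent_closed_connect clA vu uA.
Qed.

Variable R : realFieldType.

(** The probability that the process started from [S] visits [A], when both are
    parent-closed.  Until a vertex of [A] is deleted, each deletion in [A] or in its
    frontier is uniform among the vertices left there, and all those of the frontier
    must come first. *)
Definition hit A S : R :=
  if A \subset S then 'C(#|A| + #|frontier A S|, #|A|)%:R^-1 else 0.

(** The first-step equation.  Deleting a vertex of [A] makes the visit
    impossible, deleting one of the [f] frontier vertices leaves [f - 1] of them,
    and any other deletion changes neither [A] nor the frontier.  With [a = #|A|]
    and [c f = 1 / 'C(a + f, a)], what remains is the recurrence
    [(a + f) * c f = f * c (f - 1)] of the binomial coefficients. *)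
Lemma hit_harmonic A S : parent_closed A -> parent_closed S -> A != S ->
  #|S|%:R * hit A S = \sum_(v in S) hit A (cut_vertex S v).
Proof.
move=> clA clS AneqS; rewrite /hit; case: ifPn => [AS|AS]; last first.
  rewrite mulr0 big1// => v vS; case: ifPn => // AC; case/negP: AS.
  apply: fintype.subset_trans AC _; apply/fintype.subsetP => u.
  by rewrite cut_vertexE// inE => /andP[].
have prop : A \proper S by rewrite finset.properEneq AneqS.
have := frontier_neq0 clA clS prop; rewrite -card_gt0.
set F := frontier A S => F_gt0.
rewrite (big_setID A) /= (finset.setIidPr AS) big1 ?add0r; last first.
  by move=> v vA; rewrite sub_cut// vA.
have FSA : F \subset S :\: A by apply/fintype.subsetP => u; rewrite inE => /andP[].
rewrite (big_setID F) /= (finset.setIidPr FSA).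
pose c f : R := 'C(#|A| + f, #|A|)%:R^-1.
rewrite (eq_bigr (fun=> c #|F|.-1)); last first.
  move=> v vF; have /(fintype.subsetP FSA) := vF; rewrite inE => /andP[vA vS].
  by rewrite sub_cut// vA frontier_cut// /c (cardsD1 v F) vF.
rewrite [X in _ = _ + X](eq_bigr (fun=> c #|F|)); last first.
  move=> v; rewrite !inE => /andP[vF /andP[vA vS]].
  rewrite sub_cut// vA frontier_cut// /c (cardsD1 v (frontier A S)).
  by move: vF; rewrite /F !inE => /negbTE ->.
rewrite !sumr_const -/(c #|F|) -[c _ *+ _]mulr_natl -[c #|F| *+ _]mulr_natl.
have -> : #|S|%:R = (#|A| + #|F|)%:R + #|S :\: A :\: F|%:R :> R.
  rewrite -natrD; congr _%:R.
  have := finset.cardsID F (S :\: A); rewrite (finset.setIidPr FSA) -addnA => ->.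
  by rewrite cardsD (finset.setIidPr AS) subnKC// subset_leq_card.
rewrite mulrDl; congr (_ + _).
case: #|F| F_gt0 => // f _; rewrite /c /= addnS.
have bin_neq0 k : 'C(#|A| + k, #|A|)%:R != 0 :> R.
  by rewrite pnatr_eq0 -lt0n bin_gt0 leq_addr.
have := bin_neq0 f; have := bin_neq0 f.+1; rewrite addnS => H1 H0.
apply: (mulIf H1); rewrite mulfVK//; apply: (mulIf H0).
rewrite mulrAC mulfVK// -!natrM; congr _%:R.
have := mul_bin_down (#|A| + f).+1 #|A|; rewrite /= => ->.
by rewrite subSn ?leq_addr// addKn.
Qed.

End RootedTree.

(** * Leafless subtrees of the caterpillar *)

Lemma card_option_pred (U : finType) (P : {pred option U}) :
  #|P| = ((None \in P) + #|[pred x | Some x \in P]|)%N.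
Proof.
rewrite (cardD1 None); congr (_ + _)%N.
have Sinj : injective (@Some U) by move=> ? ? [].
rewrite -(fintype.card_image Sinj); apply: eq_card => -[x|].
  by rewrite !inE/= fintype.mem_image.
by rewrite !inE; apply/esym/negbTE/fintype.imageP => -[].
Qed.

Section Graft.
Variable T : rooted_graph.
Local Notation T' := (add_root_leaf T).
Implicit Types (S A : {set T}) (b : bool).

(** The subtree of the enlarged tree that contains the new root, the new leaf if
    [b] holds, and the copy of [A]. *)
Definition graft b A : {set T'} :=
  [set u : T' | match u with
                | None => true
                | Some None => b
                | Some (Some x) => x \in A
                end]%SET.

Lemma card_graft b A : #|graft b A| = (b + #|A|).+1.
Proof.
rewrite !card_option_pred !inE/= add1n.
by congr (_ + _).+1; apply: eq_card => x; rewrite !inE.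
Qed.

Lemma graftS b A b' S :
  (graft b A \subset graft b' S) = (b ==> b') && (A \subset S).
Proof.
apply/fintype.subsetP/andP => [sub|[bb' AS] [[x|]|]]; last first.
- by rewrite !inE.
- by rewrite !inE => bT; rewrite bT in bb'.
- by rewrite !inE => /(fintype.subsetP AS).
split; first by apply/implyP => bT; have := sub (Some None); rewrite !inE; apply.
by apply/fintype.subsetP => x xA; have := sub (Some (Some x)); rewrite !inE; apply.
Qed.

Lemma parent_closed_graft b A : parent_closed (graft b A) <-> parent_closed A.
Proof.
split=> clA; first by move=> x y xy yA;
  have := clA (Some (Some x)) (Some (Some y)); rewrite !inE; apply.
by move=> [[x|]|] [[y|]|] //=; rewrite !inE //; apply: clA.
Qed.

(** The new root is in both subtrees, so the frontier gains only the new leaf. *)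
Lemma card_frontier_graft A b S :
  #|frontier (graft false A) (graft b S)| = (b + #|frontier A S|)%N.
Proof.
rewrite !card_option_pred !inE/= add0n andbC; congr (_ + _)%N.
  congr nat_of_bool; case: (X in X && _) / forallP => // -[].
  by case=> [[x|]|]//=; rewrite inE.
apply: eq_card => y; rewrite !inE; congr (_ && _).
apply/forallP/forallP => par x; first by have := par (Some (Some x)); rewrite /= !inE.
by case: x => [[x|]|] //=; rewrite !inE ?implybT//; apply: par.
Qed.

Lemma leafless_graft b A : leafless (graft b A) = ~~ b && leafless A.
Proof.
have leafE x : leaf (Some (Some x) : T') = leaf x.
  apply/forallP/forallP => nochild y; first exact: (nochild (Some (Some y))).
  by case: y => [[y|]|] //; apply: nochild.
apply/forallP/andP => [nl|[bF /forallP nl] [[x|]|]].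
- split; last by apply/forallP => x; have := nl (Some (Some x)); rewrite inE leafE.
  have := nl (Some None); rewrite inE; case: b {nl} => //= /negP[].
  by apply/forallP => -[[]|].
- by rewrite inE leafE.
- by rewrite inE (negbTE bF).
- by rewrite inE /=; apply/negP => /forallP/(_ (Some None)).
Qed.

Lemma graftP (S : {set T'}) : None \in S ->
  S = graft (Some None \in S) [set x | Some (Some x) \in S].
Proof. by move=> S0; apply/setP => -[[x|]|]; rewrite !inE. Qed.

Lemma add_root_leaf_tree : is_tree T -> is_tree T'.
Proof.
case=> rooted uniq_parent root_orphan; split; last by case=> [[]|].
- have conn x y : connect (@child T) x y ->
      connect (@child T') (Some (Some x)) (Some (Some y)).
    case/connectP=> p + ->; elim: p x => [|z p IHp] x /=.
      by move=> _; exact: connect0.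
    move=> /andP[xz zp]; apply: connect_trans (IHp z zp); exact: connect1.
  case=> [[x|]|]; [|exact: connect1|exact: connect0].
  apply: connect_trans (conn _ _ (rooted x)); apply: connect1 => /=.
  exact: eqxx.
- move=> [[x|]|] [[y|]|] [[z|]|] //=.
  + by move=> xz yz; rewrite (uniq_parent _ _ _ xz yz).
  + by move=> xz /eqP zr; case/negP: (root_orphan x); rewrite -zr.
  + by move=> /eqP zr yz; case/negP: (root_orphan y); rewrite -zr.
Qed.

End Graft.

Lemma parent_closed_set0 (T : rooted_graph) :
  parent_closed (finset.set0 : {set T}).
Proof. by move=> x y _; rewrite inE. Qed.

Lemma frontier_set0 (T : rooted_graph) (S : {set T}) : is_tree T ->
  tree_root T \in S -> frontier finset.set0 S = [set tree_root T]%SET.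
Proof.
case=> rooted _ root_orphan rS; apply/setP => y; rewrite !inE /=.
have [->|yr] := eqVneq y; first rewrite rS /=.
  by apply/forallP => x; rewrite (negbTE (root_orphan x)).
apply/negbTE; rewrite negb_and; apply/orP; right.
have /connectP[p] := rooted y; case/lastP: p => [_ /eqP|p z].
  by rewrite (negbTE yr).
rewrite rcons_path last_rcons => /andP[_ pz] yE.
by apply/forallPn; exists (last (tree_root T) p); rewrite inE yE pz.
Qed.

Lemma frontier_id (T : rooted_graph) (S : {set T}) :
  frontier S S = finset.set0.
Proof. by apply/setP => y; rewrite !inE andNb. Qed.

(** The first [k] non-leaf vertices of the caterpillar, counted from the root;
    all [n] of them when [k] exceeds [n]. *)
Fixpoint spine n k : {set caterpillar n} :=
  match n, k with
  | n'.+1, k'.+1 => graft false (spine n' k')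
  | _, _ => finset.set0
  end.

Lemma caterpillar_tree n : is_tree (caterpillar n).
Proof.
elim: n => [|n IHn]; last exact: add_root_leaf_tree.
by split=> //; case; exact: connect0.
Qed.

Lemma spine0 n : spine n 0 = finset.set0. Proof. by case: n. Qed.

Lemma card_spine n k : (k <= n)%N -> #|spine n k| = k.
Proof.
elim: n k => [|n IHn] [|k] //; rewrite ?cards0//= ltnS => kn.
by rewrite card_graft IHn.
Qed.

Lemma parent_closed_spine n k : parent_closed (spine n k).
Proof.
elim: n k => [|n IHn] [|k]; try exact: parent_closed_set0.
exact/parent_closed_graft.
Qed.

Lemma leafless_spine n k : leafless (spine n k).
Proof.
elim: n k => [|n IHn] [|k] /=; try by apply/forallP => x; rewrite inE.
by rewrite leafless_graft IHn.
Qed.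

(** By induction on [n]: a nonempty subtree contains the root, and being leafless
    it misses the leaf below the root, so that it is determined by what it leaves
    in the copy of the smaller caterpillar. *)
Lemma spineP n (S : {set caterpillar n}) : parent_closed S -> leafless S ->
  S = spine n #|S|.
Proof.
elim: n S => [|n IHn] S clS nlS.
  have : tt \notin S.
    apply/negP => S0; have /forallP/(_ tt) := nlS.
    by rewrite S0 /= => /negP[]; apply/forallP.
  by move=> S0; apply/setP => -[]; rewrite inE (negbTE S0).
have [S0|S0] := boolP (None \in S); last first.
  suff -> : S = finset.set0 by rewrite cards0.
  apply/setP => u; rewrite inE; apply: contraNF S0.
  by case: (caterpillar_tree n.+1) => rooted _ _; apply: parent_closed_connect.
have SE := graftP S0; rewrite SE leafless_graft in nlS.
case/andP: nlS => /negbTE bF nlS; rewrite bF in SE.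
rewrite SE in clS; move/parent_closed_graft in clS.
by rewrite [in RHS]SE card_graft add0n /= -IHn.
Qed.

Lemma spine_sub n j k : (j <= n)%N -> (k <= n)%N ->
  (spine n j \subset spine n k) = (j <= k)%N.
Proof.
elim: n j k => [|n IHn] [|j] [|k] //= jn kn; rewrite ?finset.sub0set//.
  by apply/negbTE/fintype.subsetPn; exists None; rewrite inE.
by rewrite graftS IHn.
Qed.

Lemma card_frontier_spine n j k : (j < k <= n)%N ->
  #|frontier (spine n j) (spine n k)| = 1%N.
Proof.
elim: n j k => [|n IHn] [|j] [|k] //; rewrite ?andbF//= => jkn; last first.
  by rewrite card_frontier_graft IHn.
by rewrite frontier_set0 ?cards1 ?inE//; exact: (caterpillar_tree n.+1).
Qed.

(** The frontier consists of the [k] leaves attached to the spine and of the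
    vertex that follows it, which is a leaf when [k = n]. *)
Lemma card_frontier_spineT n k : (k <= n)%N ->
  #|frontier (spine n k) [set: caterpillar n]%SET| = k.+1.
Proof.
elim: n k => [|n IHn] [|k] // kn; rewrite ?spine0; try by
  rewrite frontier_set0 ?cards1 ?inE//; exact: caterpillar_tree.
have -> : [set: caterpillar n.+1]%SET = graft true [set: caterpillar n]%SET.
  by apply/setP => -[[x|]|]; rewrite !inE.
by rewrite /= card_frontier_graft IHn.
Qed.

Section FinalSize.
Variables (R : realFieldType) (n m : nat).
Hypothesis mn : (m <= n)%N.
Implicit Types S : {set caterpillar n}.

(** The probability that the first leafless subtree has size [m], for the process
    started from [S].  Once leafless, the subtree is a spine at every later time.
    Hence the process stops at the spine of size [m] unless it enters that spine
    from a longer one, of size [k]; this happens when the spine of size [k] is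
    visited and the vertex cut there is the single one, out of [k], that leaves
    [m] vertices. *)
Definition final_size_prob S : R :=
  hit R (spine n m) S - \sum_(m.+1 <= k < n.+1) hit R (spine n k) S / k%:R.

Lemma hit_spine j k : (j <= n)%N -> (k <= n)%N ->
  hit R (spine n j) (spine n k) =
  if (j < k)%N then j.+1%:R^-1 else (j == k)%:R.
Proof.
move=> jn kn; rewrite /hit spine_sub// card_spine//; case: ltngtP => [jk|//|->].
  by rewrite card_frontier_spine ?jk// addn1 binSn.
by rewrite frontier_id cards0 addn0 binn invr1.
Qed.

Lemma hit_spineT k : (k <= n)%N ->
  hit R (spine n k) [set: caterpillar n]%SET = 'C(k.*2.+1, k)%:R^-1.
Proof.
by move=> kn; rewrite /hit finset.subsetT card_spine// card_frontier_spineT//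
  addnS addnn.
Qed.

Lemma final_size_probT : final_size_prob [set: caterpillar n]%SET =
  'C(m.*2.+1, m)%:R^-1 -
  \sum_(m.+1 <= k < n.+1) (k%:R * 'C(k.*2.+1, k)%:R)^-1.
Proof.
rewrite /final_size_prob hit_spineT//; congr (_ - _).
rewrite !big_nat; apply: eq_bigr => k /andP[_ kn].
by rewrite hit_spineT// invfM mulrC.
Qed.

Lemma sum_inv_telescope j : (m <= j)%N ->
  \sum_(m.+1 <= k < j.+1) (k.+1%:R * k%:R)^-1 = m.+1%:R^-1 - j.+1%:R^-1 :> R.
Proof.
elim: j => [|j IHj]; first by rewrite leqn0 => /eqP ->; rewrite big_geq// subrr.
rewrite leq_eqVlt => /predU1P[<-|]; first by rewrite big_geq// subrr.
rewrite ltnS => mj; rewrite big_nat_recr//= IHj//.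
have : j.+2%:R != 0 :> R by rewrite pnatr_eq0.
have : j.+1%:R != 0 :> R by rewrite pnatr_eq0.
rewrite -[j.+2%:R]natr1; move: m.+1%:R^-1 j.+1%:R => b a a0 a10.
by field; rewrite a10.
Qed.

(** From the spine of size [j], the spine of size [k < j] has a single frontier
    vertex and is visited with probability [1 / (k + 1)]; for [m < j] the
    subtracted terms, [1 / (k * (k + 1))] for [m < k < j] and [1 / j] for [k = j],
    telescope to [1 / (m + 1)]. *)
Lemma final_size_prob_leafless S : parent_closed S -> leafless S ->
  final_size_prob S = (#|S| == m)%:R.
Proof.
move=> clS nlS; have SE := spineP clS nlS.
have jn : (#|S| <= n)%N.
  have : (#|S| <= #|spine n n|)%N.
    rewrite {1}SE; elim: (n) (#|S|) => [|p IHp] [|j]; rewrite ?cards0//=.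
    by rewrite !card_graft ltnS IHp.
  by rewrite card_spine.
rewrite SE card_spine//; move: #|S| jn => j jn {S SE clS nlS}.
rewrite /final_size_prob hit_spine//.
have hitE k : (m.+1 <= k < n.+1)%N -> hit R (spine n k) (spine n j) =
    if (k < j)%N then k.+1%:R^-1 else (k == j)%:R.
  by case/andP=> _ kn; rewrite hit_spine.
rewrite big_nat (eq_bigr _ (fun k kP => congr1 (fun c => c / _) (hitE k kP))).
rewrite -big_nat; case: ltngtP => [mj|jm|->]; last 2 first.
- rewrite big_nat big1 ?subr0// => k /andP[mk _].
  by rewrite ltnNge (ltnW (ltn_trans jm mk)) /= gtn_eqF ?mul0r// (ltn_trans jm).
- rewrite big_nat big1 ?subr0// => k /andP[mk _].
  by rewrite ltnNge (ltnW mk) /= gtn_eqF// mul0r.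
case: j mj jn hitE => // j; rewrite ltnS => mj jn _.
rewrite (big_cat_nat (n := j.+1)) ?ltnS ?(ltnW jn)//=.
rewrite [X in _ - (_ + X)]big_ltn//= ltnn eqxx.
rewrite [X in _ - (_ + (_ + X))]big_nat [X in _ - (_ + (_ + X))]big1; last first.
  by move=> k /andP[jk _]; rewrite ltnNge (ltnW jk)/= gtn_eqF ?mul0r.
rewrite big_nat (eq_bigr (fun k => (k.+1%:R * k%:R)^-1)); last first.
  by move=> k /andP[_ kj]; rewrite kj invfM.
by rewrite -big_nat sum_inv_telescope// addr0 mul1r; ring.
Qed.

(** Each summand satisfies the first-step equation except at its own spine, which
    is leafless. *)
Lemma final_size_prob_harmonic S : parent_closed S -> ~~ leafless S ->
  #|S|%:R * final_size_prob S =
  \sum_(v in S) final_size_prob (cut_vertex S v).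
Proof.
move=> clS lS; rewrite sumrB mulrBr exchange_big/= mulr_sumr.
have hitE k : #|S|%:R * hit R (spine n k) S =
    \sum_(v in S) hit R (spine n k) (cut_vertex S v).
  apply: hit_harmonic => //; first exact: caterpillar_tree.
  - exact: parent_closed_spine.
  - by apply: contraNneq lS => <-; apply: leafless_spine.
rewrite hitE; congr (_ - _); apply: eq_bigr => k _.
by rewrite mulrA hitE mulr_suml.
Qed.

End FinalSize.

(** * From the first-step equation to the law of the process *)

Lemma probability_finite_partition d (Omega : measurableType d) (R : realType)
    (P : probability Omega R) (U : finType) (X : Omega -> U) (A : set Omega) :
    (forall v, measurable (X @^-1` [set v])) -> measurable A ->
  fine (P A) = \sum_(v : U) fine (P (A `&` X @^-1` [set v])).
Proof.
move=> mX mA; have mAX v : measurable (A `&` X @^-1` [set v]) by exact: measurableI.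
have {1}-> : A = \bigcup_(v in [set: U]) (A `&` X @^-1` [set v]).
  by apply/seteqP; split=> [w Aw|w [v _ []]//]; exists (X w).
rewrite measure_fin_bigcup//; [|exact: finite_finset|]; last first.
  by apply: trivIset_setIl; exact: trivIset_preimage1.
rewrite (@fsbigE _ _ _ _ _ (index_enum U))//; first last.
- by move=> v _; rewrite mem_index_enum.
- exact: index_enum_uniq.
rewrite (eq_bigl xpredT) => [|v]; last by rewrite in_setT.
by rewrite sum_fine// => v _; exact: fin_num_measure.
Qed.

Lemma remaining_rcons (T : rooted_graph) (h : seq T) v :
  remaining (rcons h v) = cut_vertex (remaining h) v.
Proof. by rewrite /remaining -cats1 foldl_cat. Qed.

Lemma parent_closed_remaining (T : rooted_graph) (h : seq T) :
  is_tree T -> parent_closed (remaining h).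
Proof.
move=> Ttree; elim/last_ind: h => [|h v IHh]; first by move=> x y _ _; rewrite inE.
by rewrite remaining_rcons; apply: parent_closed_cut.
Qed.

Section Process.
Variables (T : rooted_graph) (d : measure_display) (Omega : measurableType d).
Variables (R : realType) (P : probability Omega R) (C : cutting_process T P).
Hypothesis Ttree : is_tree T.
Local Notation c := (chosen C).
Implicit Types (h : seq T) (v : T) (E : set Omega).

Definition starts_with h : set Omega := [set w | history c (size h) w = h].

Lemma starts_with_nil : starts_with [::] = setT.
Proof. by apply/seteqP; split. Qed.

Lemma starts_with_rcons h v :
  starts_with (rcons h v) = starts_with h `&` c (size h) @^-1` [set v].
Proof.
rewrite /starts_with /history size_rcons; apply/seteqP.
by split=> w /=; rewrite mkseqS; [case/rcons_inj|case=> -> ->].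
Qed.

Lemma measurable_starts_with h : measurable (starts_with h).
Proof.
elim/last_ind: h => [|h v IHh]; first by rewrite starts_with_nil.
by rewrite starts_with_rcons; apply: measurableI => //; exact: chosen_measurable.
Qed.

Lemma measurable_history (Q : pred (seq T)) i :
  measurable [set w | Q (history c i w)].
Proof.
have -> : [set w | Q (history c i w)] =
    \bigcup_(h in [set h : i.-tuple T | Q h]) starts_with h.
  apply/seteqP; split=> [w Qw|w [h Qh]]; last first.
    by rewrite /starts_with/= size_tuple => ->.
  have sz : size (history c i w) == i by rewrite size_mkseq.
  by exists (Tuple sz) => //; rewrite /starts_with/= (eqP sz).
by apply: fin_bigcup_measurable => // h _; exact: measurable_starts_with.
Qed.

Lemma starts_with_uniform h v : v \in remaining h ->
  fine (P (starts_with (rcons h v))) =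
  fine (P (starts_with h)) / #|remaining h|%:R.
Proof.
move=> vh; rewrite starts_with_rcons.
have := chosen_uniform C vh; rewrite -[LHS]/(P (_ `&` _)) => ->.
by rewrite fineM ?fin_num_measure//; exact: measurable_starts_with.
Qed.

(** The vertices of the current tree already carry the whole mass of the event, so
    nothing is left for the others. *)
Lemma starts_with_outside h v : v \notin remaining h ->
  remaining h != finset.set0 -> fine (P (starts_with (rcons h v))) = 0.
Proof.
move=> vh; rewrite -card_gt0 => h_gt0.
have := probability_finite_partition P (chosen_measurable C (size h))
  (measurable_starts_with h).
under eq_bigr do rewrite -starts_with_rcons.
rewrite (bigID (mem (remaining h)))/=.
under eq_bigr => u uh do rewrite starts_with_uniform//.
rewrite sumr_const -[X in _ = X + _]mulr_natr mulfVK ?pnatr_eq0 -?lt0n//.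
move=> /eqP; rewrite -subr_eq0 opprD addNKr oppr_eq0 psumr_eq0; last first.
  by move=> u _; apply: fine_ge0.
by move=> /allP/(_ v); rewrite mem_index_enum vh => /(_ isT)/eqP.
Qed.

(** The histories at whose end the tree is leafless for the first time. *)
Definition stops h := leafless (remaining h) &&
  [forall j : 'I_(size h), ~~ leafless (remaining (take j h))].

Lemma stopsP i w : reflect
  (leafless (tree_at c i w) /\ forall j, (j < i)%N -> ~~ leafless (tree_at c j w))
  (stops (history c i w)).
Proof.
have takeE j : (j < i)%N -> take j (history c i w) = history c j w.
  by move=> ji; rewrite /history /mkseq -map_take take_iota (minn_idPl (ltnW ji)).
apply: (iffP andP); rewrite size_mkseq => -[lf early]; split=> //.
  move=> j ji; have /forallP/(_ (Ordinal ji)) := early.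
  by rewrite /= takeE.
by apply/forallP => j; rewrite takeE//; apply: early.
Qed.

Lemma separation_timeE i w : stops (history c i w) -> separation_time c w = i.
Proof.
move=> /stopsP[lf early]; apply: xget_unique => // j [lfj earlyj].
by case: (ltngtP j i) => // [/early|/earlyj]; rewrite ?lf ?lfj.
Qed.

Lemma starts_with_separated h w : stops h -> starts_with h w ->
  separated_graph c w = remaining h.
Proof.
move=> hstop hw; rewrite /separated_graph (@separation_timeE (size h)) ?hw//.
by rewrite /tree_at hw.
Qed.

(** The separated graph is a function of the history up to the separation time,
    except on the event of no separation, where the time is [0] by convention and
    the graph is the whole tree. *)
Lemma measurable_separated_graph (Q : pred {set T}) :
  measurable [set w | Q (separated_graph c w)].
Proof.
pose S i := [set w | stops (history c i w)].
have -> : [set w | Q (separated_graph c w)] =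
    \bigcup_i [set w | stops (history c i w) && Q (remaining (history c i w))] `|`
    (~` (\bigcup_i S i) `&` [set w | Q [set: T]%SET]).
  apply/seteqP; split=> [w Qw|w [[i _ /= /andP[st Qi]]|[nst Q0]]] /=; last 2 first.
  - by rewrite (@starts_with_separated (history c i w))// /starts_with/= size_mkseq.
  - rewrite /separated_graph /separation_time xgetPN// => i /stopsP st.
    by apply: nst; exists i.
  have [[i _ st]|nst] := pselect ((\bigcup_i S i) w).
    left; exists i => //=; rewrite st.
    by rewrite -(@starts_with_separated _ w st)// /starts_with/= size_mkseq.
  right; split=> //; move: Qw.
  rewrite /= /separated_graph /separation_time xgetPN// => i /stopsP st.
  by apply: nst; exists i.
apply: measurableU.
  apply: bigcupT_measurable => i.
  exact: (measurable_history (fun h => stops h && Q (remaining h))).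
apply: measurableI.
  by apply: measurableC; apply: bigcupT_measurable => i; exact: measurable_history.
case: (Q _); last by rewrite (_ : [set _ | _] = set0)//; apply/seteqP; split.
by rewrite (_ : [set _ | _] = setT)//; apply/seteqP; split.
Qed.

(** If [g] satisfies the first-step equation at the subtrees that are not
    leafless and gives the conditional probability of [E] when the process stops,
    then it gives that probability at every earlier time, by induction on the
    number of remaining vertices: condition on the next deletion. *)
Lemma optional_stopping (g : {set T} -> R) E : measurable E ->
    (forall S, parent_closed S -> ~~ leafless S ->
       #|S|%:R * g S = \sum_(v in S) g (cut_vertex S v)) ->
    (forall h, stops h -> fine (P (starts_with h `&` E)) =
       fine (P (starts_with h)) * g (remaining h)) ->
  fine (P E) = g [set: T]%SET.
Proof.
move=> mE harmonic atstop.
suff main n h : (#|remaining h| <= n)%N ->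
    [forall j : 'I_(size h), ~~ leafless (remaining (take j h))] ->
    fine (P (starts_with h `&` E)) = fine (P (starts_with h)) * g (remaining h).
  have := main _ [::] (leqnn _); rewrite starts_with_nil setTI probability_setT.
  by rewrite mul1r; apply; apply/forallP => -[].
elim: n h => [|n IHn] h hn early; have [lf|nlf] := boolP (leafless (remaining h)).
- by apply: atstop; rewrite /stops lf.
- case/negP: nlf; move: hn; rewrite leqn0 cards_eq0 => /eqP ->.
  by apply/forallP => x; rewrite inE.
- by apply: atstop; rewrite /stops lf.
have h0 : remaining h != finset.set0.
  by apply: contraNneq nlf => ->; apply/forallP => x; rewrite inE.
rewrite (probability_finite_partition P (chosen_measurable C (size h))); last first.
  by apply: measurableI => //; exact: measurable_starts_with.
under eq_bigr => v _ do rewrite setIAC -starts_with_rcons.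
rewrite (bigID (mem (remaining h)))/= [X in _ + X]big1 ?addr0; last first.
  move=> v vh; apply/eqP; rewrite eq_le fine_ge0// andbT.
  rewrite -(starts_with_outside vh h0) fine_le//.
  - by apply: fin_num_measure; apply: measurableI => //; exact: measurable_starts_with.
  - by apply: fin_num_measure; exact: measurable_starts_with.
  rewrite le_measure ?inE//; first last.
  - exact: measurable_starts_with.
  - by apply: measurableI => //; exact: measurable_starts_with.
transitivity (\sum_(v in remaining h) fine (P (starts_with h)) /
    #|remaining h|%:R * g (cut_vertex (remaining h) v)).
  apply: eq_bigr => v vh; rewrite IHn.
  - by rewrite remaining_rcons starts_with_uniform.
  - rewrite remaining_rcons -ltnS; exact: leq_trans (cut_vertex_lt vh) hn.
  apply/forallP => -[j jhv] /=; have := jhv.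
  rewrite [in X in X -> _]size_rcons ltnS leq_eqVlt => /predU1P[->|jh].
    by rewrite -cats1 take_size_cat.
  by rewrite -cats1 takel_cat ?(ltnW jh)//; apply: (forallP early (Ordinal jh)).
rewrite -mulr_sumr -harmonic//; last exact: parent_closed_remaining.
by rewrite mulrA mulfVK// pnatr_eq0 cards_eq0.
Qed.

End Process.

Lemma final_size_law d (Omega : measurableType d) (R : realType)
    (P : probability Omega R) n m (C : cutting_process (caterpillar n) P) :
  (m <= n)%N ->
  fine (P [set w | #|separated_graph (chosen C) w| = m]) =
  'C(m.*2.+1, m)%:R^-1 -
  \sum_(m.+1 <= k < n.+1) (k%:R * 'C(k.*2.+1, k)%:R)^-1.
Proof.
move=> mn; rewrite -final_size_probT//.
have -> : [set w | #|separated_graph (chosen C) w| = m] =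
    [set w | #|separated_graph (chosen C) w| == m].
  by apply/seteqP; split=> w /= /eqP.
have mE := measurable_separated_graph C (fun S => #|S| == m).
apply: (@optional_stopping _ _ _ _ _ C (caterpillar_tree n)) => //.
  by move=> S; apply: final_size_prob_harmonic.
move=> h hstop; have /andP[lf _] := hstop.
have clh := @parent_closed_remaining _ h (caterpillar_tree n).
rewrite final_size_prob_leafless//; case: (boolP (_ == m)) => hm.
  rewrite mulr1; congr (fine (P _)); apply/seteqP; split=> [w []//|w hw].
  by split=> //=; rewrite (starts_with_separated hstop hw).
rewrite mulr0 (_ : _ `&` _ = set0) ?measure0//; apply/seteqP; split=> // w [hw].
by rewrite /= (starts_with_separated hstop hw) (negbTE hm).
Qed.

(** * The integrals *)

Section Integrals.
Variable R : realType.
Local Notation mu := (@lebesgue_measure R).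
Implicit Types (x : R) (n m : nat) (p : {poly R}).

Lemma Rintegral01_FTC (F f : R -> R) :
    (forall x, is_derive x 1 F (f x)) -> continuous f ->
  \int[mu]_(x in `[0, 1]) f x = F 1 - F 0.
Proof.
move=> dF cf; have cF x : {for x, continuous F}.
  by apply: differentiable_continuous; apply/derivable1_diffP; case: (dF x).
rewrite /Rintegral (@continuous_FTC2 _ f F)//.
- exact: continuous_subspaceT.
- split; [by move=> x _; case: (dF x)| |].
  + exact/cvg_at_right_filter/cF.
  + exact/cvg_at_left_filter/cF.
- by move=> x _; rewrite derive1E; case: (dF x).
Qed.

Lemma integrable01 (f : R -> R) : continuous f ->
  mu.-integrable `[0, 1] (EFin \o f).
Proof.
move=> cf; apply: continuous_compact_integrable; first exact: segment_compact.
exact: continuous_subspaceT.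
Qed.

Lemma one_minus_parabola_gt0 x : 0 < 1 - x + x ^+ 2.
Proof. by nra. Qed.

Lemma continuous_horner_div p : continuous (fun x => p.[x] / (1 - x + x ^+ 2)).
Proof.
move=> x; apply: continuousM; first exact: continuous_horner.
have -> : (fun y : R => (1 - y + y ^+ 2)^-1) = (fun y => ((1 - 'X + 'X^2).[y])^-1).
  by apply/funext => y; rewrite !hornerE.
apply: continuousV; last exact: continuous_horner.
by rewrite !hornerE gt_eqF// one_minus_parabola_gt0.
Qed.

Lemma Rintegral01_deriv p :
  \int[mu]_(x in `[0, 1]) p^`().[x] = p.[1] - p.[0].
Proof. by apply: Rintegral01_FTC; exact: continuous_horner. Qed.

(** The Beta integral [B(n + 1, n + 1)], equal to [n! * n! / (2 * n + 1)!]. *)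
Definition beta_diag n : R := (n.+1%:R * 'C(n.*2.+1, n)%:R)^-1.

Lemma beta_diag_rec n :
  (4 * n%:R + 6) * beta_diag n.+1 = n.+1%:R * beta_diag n.
Proof.
(* From 'C(2 n + 1, n) to 'C(2 n + 3, n + 1) by way of 'C(2 n + 2, n). *)
have h1 := mul_bin_diag n.*2.+3 n; have h2 := mul_bin_down n.*2.+2 n.
rewrite /= in h1 h2.
have {}h1 : n.*2.+3%:R * 'C(n.*2.+2, n)%:R = n.+1%:R * 'C(n.*2.+3, n.+1)%:R :> R.
  by rewrite -!natrM h1.
have {}h2 : n.*2.+2%:R * 'C(n.*2.+1, n)%:R = n.+2%:R * 'C(n.*2.+2, n)%:R :> R.
  by rewrite -!natrM h2; congr (_ * _)%:R; lia.
have : 'C(n.*2.+1, n)%:R != 0 :> R.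
  by rewrite pnatr_eq0 -lt0n bin_gt0; lia.
have : 'C(n.*2.+3, n.+1)%:R != 0 :> R.
  by rewrite pnatr_eq0 -lt0n bin_gt0; lia.
rewrite /beta_diag doubleS; move: h1 h2.
have -> : n.*2.+3%:R = 2 * n%:R + 3 :> R by rewrite -muln2 -addn3 natrD natrM mulrC.
have -> : n.*2.+2%:R = 2 * n%:R + 2 :> R by rewrite -muln2 -addn2 natrD natrM mulrC.
have -> : n.+2%:R = n%:R + 2 :> R by rewrite -addn2 natrD.
have -> : n.+1%:R = n%:R + 1 :> R by rewrite -natr1.
have : 0 <= n%:R :> R by [].
move: n%:R 'C(n.*2.+1, n)%:R 'C(n.*2.+2, n)%:R 'C(n.*2.+3, n.+1)%:R.
move=> t a b c t0 h1 h2 c0 a0.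
have t1 : t + 1 != 0 by rewrite gt_eqF// ltr_wpDl.
have t2 : t + 2 != 0 by rewrite gt_eqF// ltr_wpDl.
have -> : c = (2 * t + 3) * b / (t + 1) by rewrite h1 mulrAC mulfV// mul1r.
have -> : b = (2 * t + 2) * a / (t + 2) by rewrite h2 mulrAC mulfV// mul1r.
have t3 : 2 * t + 3 != 0 by rewrite gt_eqF// ltr_wpDl// mulr_ge0.
have t4 : 2 * t + 2 != 0 by rewrite gt_eqF// ltr_wpDl// mulr_ge0.
field; by rewrite t3 t4 t2 t1 a0.
Qed.

Definition parabola : {poly R} := 'X - 'X^2.

Lemma parabola_expE n x : (parabola ^+ n).[x] = (x - x ^+ 2) ^+ n.
Proof. by rewrite horner_exp /parabola !hornerE. Qed.

Lemma parabola_deriv n x : ((parabola ^+ n.+1)^`()).[x] =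
  n.+1%:R * ((1 - 2 * x) * (x - x ^+ 2) ^+ n).
Proof.
rewrite deriv_exp /= hornerMn hornerM parabola_expE /parabola derivB derivX derivXn.
rewrite hornerD hornerN hornerMn expr1 hornerX hornerC.
by rewrite -[_ *+ n.+1]mulr_natl; ring.
Qed.

(** With [u = x - x ^+ 2], the polynomial [(2 * x - 1) * u ^+ n.+1] vanishes at 0
    and at 1, and the integral of its derivative gives [beta_diag_rec]. *)
Lemma integral_beta n : \int[mu]_(x in `[0, 1]) (x - x ^+ 2) ^+ n = beta_diag n.
Proof.
elim: n => [|n IHn].
  under eq_Rintegral do rewrite expr0.
  rewrite Rintegral_cst//= lebesgue_measure_itv/= lte_fin ltr01 oppr0 adde0.
  by rewrite /beta_diag /= bin0 !mul1r invr1.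
apply: (@mulfI _ (4 * n%:R + 6)); first by rewrite gt_eqF// ltr_wpDl// mulr_ge0.
rewrite beta_diag_rec -IHn; apply/eqP; rewrite -subr_eq0; apply/eqP.
have int k a : mu.-integrable `[0, 1] (EFin \o (fun x => a * (x - x ^+ 2) ^+ k)).
  apply: integrable01; rewrite (_ : (fun x => _) = horner (a *: parabola ^+ k)).
    exact: continuous_horner.
  by apply/funext => x; rewrite hornerZ parabola_expE.
have int1 k : mu.-integrable `[0, 1] (EFin \o (fun x => (x - x ^+ 2) ^+ k)).
  by have := int k 1; under [X in EFin \o X]eq_fun do rewrite mul1r.
rewrite -!RintegralZl// -RintegralB//.
pose p := (2 *: 'X - 1) * parabola ^+ n.+1.
have pE x : p^`().[x] =
    (4 * n%:R + 6) * (x - x ^+ 2) ^+ n.+1 - n.+1%:R * (x - x ^+ 2) ^+ n.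
  rewrite /p -polyC1 derivM derivB derivZ derivX derivC subr0 hornerD !hornerM.
  rewrite parabola_deriv parabola_expE hornerD hornerN !hornerZ hornerX !hornerC.
  by rewrite exprS -natr1; ring.
under eq_Rintegral do rewrite -pE.
rewrite Rintegral01_deriv /p -polyC1 !hornerM !parabola_expE !hornerD !hornerN.
by rewrite !hornerZ !hornerX !hornerC !exprS; ring.
Qed.

(** Since [1 - x + x ^+ 2 = 1 - u] for [u = x - x ^+ 2], this is [x] times the
    geometric series of the powers of [u] from the exponent [n] on. *)
Definition geometric_tail n x : R := x * (x - x ^+ 2) ^+ n / (1 - x + x ^+ 2).

Lemma continuous_geometric_tail n : continuous (geometric_tail n).
Proof.
rewrite (_ : geometric_tail n = fun x => ('X * parabola ^+ n).[x] / (1 - x + x ^+ 2)).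
  exact: continuous_horner_div.
by apply/funext => x; rewrite hornerM hornerX parabola_expE.
Qed.

Definition tail_integral n : R := \int[mu]_(x in `[0, 1]) geometric_tail n x.

(** The difference is the integral of [x * u ^+ n] for [u = x - x ^+ 2].  As [u] is
    symmetric under [x |-> 1 - x], the factor [x] averages to [1 / 2]; formally,
    [(1 - 2 * x) * u ^+ n] is up to a constant the derivative of [u ^+ n.+1], which
    vanishes at both ends. *)
Lemma tail_integral_rec n : tail_integral n - tail_integral n.+1 = beta_diag n / 2.
Proof.
have cX : continuous (fun x : R => x * (x - x ^+ 2) ^+ n).
  rewrite (_ : (fun x => _) = horner ('X * parabola ^+ n)).
    exact: continuous_horner.
  by apply/funext => x; rewrite hornerM hornerX parabola_expE.
have cu : continuous (fun x : R => (x - x ^+ 2) ^+ n).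
  rewrite (_ : (fun x => _) = horner (parabola ^+ n)); first exact: continuous_horner.
  by apply/funext => x; rewrite parabola_expE.
rewrite /tail_integral -RintegralB//; last 2 first.
- exact/integrable01/continuous_geometric_tail.
- exact/integrable01/continuous_geometric_tail.
transitivity (\int[mu]_(x in `[0, 1]) (x * (x - x ^+ 2) ^+ n)).
  apply: eq_Rintegral => x _; rewrite /geometric_tail [_ ^+ n.+1]exprS.
  move: ((x - x ^+ 2) ^+ n) => u; field.
  by rewrite gt_eqF// one_minus_parabola_gt0.
have : \int[mu]_(x in `[0, 1]) ((parabola ^+ n.+1)^`()).[x] = 0.
  by rewrite Rintegral01_deriv !parabola_expE !exprS; ring.
have n0 : n.+1%:R != 0 :> R by rewrite pnatr_eq0.
under eq_Rintegral do rewrite parabola_deriv.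
have -> : (fun x : R => n.+1%:R * ((1 - 2 * x) * (x - x ^+ 2) ^+ n)) =
    (fun x => n.+1%:R * ((x - x ^+ 2) ^+ n - 2 * (x * (x - x ^+ 2) ^+ n))).
  by apply/funext => x; ring.
have c2 : continuous (fun x : R => 2 * (x * (x - x ^+ 2) ^+ n)).
  by move=> x; apply: cvgM; [exact: cvg_cst|exact: cX].
rewrite RintegralZl//; last first.
  by apply: integrable01 => x; apply: cvgB; [exact: cu|exact: c2].
move=> /eqP; rewrite mulf_eq0 (negbTE n0) /= RintegralB//; last 2 first.
- exact: integrable01.
- exact: integrable01.
rewrite RintegralZl//; last exact: integrable01.
by rewrite integral_beta subr_eq0 => /eqP ->; rewrite mulrC mulKf.
Qed.

(** On the unit interval [x <= 1 <= 2 * (1 - x + x ^+ 2)]. *)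
Lemma tail_integral_bound n : 0 <= tail_integral n <= 2 * beta_diag n.
Proof.
have u01 x : x \in `[0, 1] -> 0 <= x - x ^+ 2.
  by rewrite in_itv/= => /andP[x0 x1]; nra.
have cu : continuous (fun x : R => 2 * (x - x ^+ 2) ^+ n).
  rewrite (_ : (fun x => _) = horner (2 *: parabola ^+ n)).
    exact: continuous_horner.
  by apply/funext => x; rewrite hornerZ parabola_expE.
have cu1 : continuous (fun x : R => (x - x ^+ 2) ^+ n).
  rewrite (_ : (fun x => _) = horner (parabola ^+ n)); first exact: continuous_horner.
  by apply/funext => x; rewrite parabola_expE.
rewrite Rintegral_ge0/=; last first.
  move=> x /= x01; have d0 := ltW (one_minus_parabola_gt0 x).
  rewrite divr_ge0 ?mulr_ge0 ?exprn_ge0 ?u01//.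
  by move: x01; rewrite in_itv/= => /andP[].
rewrite -integral_beta -RintegralZl//; last exact: integrable01.
apply: le_Rintegral => //; [|exact: integrable01|].
  exact/integrable01/continuous_geometric_tail.
move=> x /= x01; rewrite /geometric_tail ler_pdivrMr ?one_minus_parabola_gt0//.
rewrite -mulrA [leRHS]mulrCA.
have := exprn_ge0 n (u01 x x01).
move: x01; rewrite in_itv/= => /andP[x0 x1] u0.
by rewrite mulrC ler_wpM2l//; nra.
Qed.

(** The triplication formula for the cosine, at [pi / 6], yields
    [cos ^+ 2 = 3 * sin ^+ 2]. *)
Lemma atan_inv_sqrt3 : atan (Num.sqrt 3)^-1 = pi / 6 :> R.
Proof.
have pi0 := pi_gt0 R; have pi6 : 0 < (pi / 6 : R) < pi / 2.
  by apply/andP; split; lra.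
have s0 := sin_gt0_pihalf pi6.
have c0 : 0 < cos (pi / 6 : R).
  by apply: cos_gt0_pihalf; case/andP: pi6 => ? ?; apply/andP; split => //; lra.
have cs := cos2Dsin2 (pi / 6 : R).
have := cos_pihalf R.
rewrite (_ : pi / 2 = pi / 6 + pi / 6 + pi / 6); last by field.
rewrite !cosD sinD => c3; rewrite -[RHS]tanK; last first.
  by rewrite in_itv/=; case/andP: pi6 => ? ?; apply/andP; split => //; lra.
congr atan; rewrite /tan; move: s0 c0 cs c3.
move: (sin _) (cos _) => s c s0 c0 cs c3.
have c2 : c ^+ 2 = 3 * s ^+ 2.
  by apply: (mulfI (lt0r_neq0 c0)); nra.
have -> : c = Num.sqrt 3 * s.
  apply/eqP; rewrite -(eqrXn2 (n := 2))// ?mulr_ge0 ?sqrtr_ge0 ?ltW//.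
  by rewrite exprMn sqr_sqrtr// c2.
rewrite invfM mulrCA mulfV ?mulr1// lt0r_neq0//.
Qed.

(** A primitive of [x / (1 - x + x ^+ 2)] is
    [ln (1 - x + x ^+ 2) / 2 + atan ((2 * x - 1) / sqrt 3) / sqrt 3]; the logarithm
    vanishes at both ends and the arctangent runs from [- pi / 6] to [pi / 6]. *)
Lemma tail_integral0 : tail_integral 0 = pi / (3 * Num.sqrt 3).
Proof.
pose s : R := Num.sqrt 3.
have s2 : s ^+ 2 = 3 by rewrite sqr_sqrtr.
have s0 : s != 0 by rewrite lt0r_neq0// sqrtr_gt0.
pose q : {poly R} := 'X^2 - 'X + 1%:P; pose l : {poly R} := s^-1 *: ('X *+ 2 - 1%:P).
have qE x : q.[x] = 1 - x + x ^+ 2.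
  by rewrite /q hornerD hornerD hornerN hornerXn hornerX hornerC; ring.
have lE x : l.[x] = (2 * x - 1) / s.
  by rewrite /l hornerZ hornerD hornerN hornerMn hornerX hornerC; ring.
pose F := 2^-1 \*: (@ln R \o horner q) + s^-1 \*: (@atan R \o horner l).
have dF x : is_derive x 1 F (geometric_tail 0 x).
  have dln : is_derive (q.[x]) 1 (@ln R) (q.[x])^-1.
    by apply: is_derive1_ln; rewrite qE one_minus_parabola_gt0.
  have datan := is_derive1_atan l.[x].
  apply: is_derive_eq.
  rewrite /geometric_tail expr0 mulr1 /GRing.scale /= qE lE.
  rewrite /q /l !(derivD, derivN, derivXn, derivZ, derivC, derivMn, derivX).
  rewrite !(hornerD, hornerN, hornerZ, hornerMn, hornerX, hornerC).
  have -> : 1 + ((2 * x - 1) / s) ^+ 2 = 4 / 3 * (1 - x + x ^+ 2).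
    by rewrite expr_div_n s2; field.
  (* Only the square of s is known in closed form. *)
  have -> a b : s^-1 * (a * (s^-1 * b)) = a * b / s ^+ 2 by field.
  by rewrite s2; field; rewrite gt_eqF// one_minus_parabola_gt0.
rewrite /tail_integral (Rintegral01_FTC dF); last exact: continuous_geometric_tail.
rewrite /F /= !fctE /= !qE !lE.
have -> : (2 * 1 - 1) / s = s^-1 by rewrite mulr1 -[X in X - 1]natr1 addrK mul1r.
have -> : (2 * 0 - 1) / s = - s^-1 by rewrite mulr0 sub0r mulN1r.
rewrite atanN atan_inv_sqrt3 subrr add0r subr0 expr1n expr0n addr0 ln1 -/s.
by rewrite /GRing.scale /=; field.
Qed.

End Integrals.

(** * Convergence in distribution on the natural numbers *)

Section DiscreteConvergence.
Variable R : realType.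

Lemma measurable_preimage_nat d (Omega : measurableType d) (X : Omega -> nat) A :
  (forall k, measurable (X @^-1` [set k])) -> measurable (X @^-1` A).
Proof.
move=> mX; have -> : X @^-1` A = \bigcup_(k in A) X @^-1` [set k].
  by apply/seteqP; split=> [w Aw|w [k Ak /= ->]//]; exists (X w).
exact: bigcup_measurable.
Qed.

Section Truncation.
Context d (Omega : measurableType d) (P : probability Omega R).
Variable X : Omega -> nat.
Hypothesis mX : forall k, measurable (X @^-1` [set k]).
Implicit Types f g : nat -> R.

Lemma integrable_nat_valued g B : (forall k, `|g k| <= B) ->
  P.-integrable setT (EFin \o (fun w => g (X w))).
Proof.
move=> gB; apply: measurable_bounded_integrable => //.
- by rewrite -ge0_fin_numE// fin_num_measure.
- move=> _ Y mY; rewrite setTI (_ : _ @^-1` Y = X @^-1` (g @^-1` Y))//.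
  exact: measurable_preimage_nat.
- by exists B; split=> [|M BM w _ /=]; rewrite ?num_real// (le_trans (gB _)) ?ltW.
Qed.

Definition tail_from N f : nat -> R := fun k => if (k < N)%N then 0 else f k.

Lemma integral_tail f B N : (forall k, `|f k| <= B) ->
  \int[P]_w tail_from N f (X w) = \int[P]_w f (X w) -
    \sum_(k < N) f k * fine (P (X @^-1` [set k : nat])).
Proof.
move=> fB; elim: N => [|N IHN]; first by rewrite big_ord0 subr0.
have tB M k : `|tail_from M f k| <= B.
  by rewrite /tail_from; case: ifP => // _; rewrite normr0 (le_trans _ (fB 0)).
have pB k : `|f N * (k == N)%:R| <= B.
  rewrite normrM; case: eqP => _; rewrite ?normr1 ?mulr1// normr0 mulr0.
  exact: le_trans (fB 0).
rewrite big_ord_recr /= opprD addrA -IHN.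
transitivity (\int[P]_w (tail_from N f (X w) - f N * (X w == N)%:R)).
  apply: eq_Rintegral => w _; rewrite /tail_from ltnS leq_eqVlt.
  by have [->|] := eqVneq; rewrite ?ltnn ?mulr1 ?subrr ?mulr0 ?subr0.
rewrite RintegralB//; [|exact: integrable_nat_valued (tB N)|
  exact: (integrable_nat_valued pB)].
congr (_ - _).
have ind_int : P.-integrable setT (EFin \o (fun w => (X w == N)%:R : R)).
  apply: (@integrable_nat_valued (fun k => (k == N)%:R) 1) => k.
  by case: eqP; rewrite ?normr1 ?normr0.
rewrite RintegralZl//; congr (_ * _).
have -> : (fun w => (X w == N)%:R : R) = \1_(X @^-1` [set N]).
  by apply/funext => w; rewrite indicE; congr (nat_of_bool _)%:R;
    apply/eqP/idP; rewrite in_setE.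
by rewrite /Rintegral integral_indic// setIT.
Qed.

(** The error is the contribution of the values from [N] on, hence at most [B]
    times their probability; both are read off from [integral_tail], the second
    for the constant function [1]. *)
Lemma expectation_truncation f B N : (forall k, `|f k| <= B) ->
  `|\int[P]_w f (X w) - \sum_(k < N) f k * fine (P (X @^-1` [set k : nat]))| <=
  B * (1 - \sum_(k < N) fine (P (X @^-1` [set k : nat]))).
Proof.
move=> fB; rewrite -(integral_tail _ fB).
have B0 : 0 <= B by exact: le_trans (fB 0).
have c1 (k : nat) : `|1 : R| <= 1 by rewrite normr1.
have -> : 1 - \sum_(k < N) fine (P (X @^-1` [set k : nat])) =
    \int[P]_w tail_from N (fun=> 1) (X w).
  rewrite (integral_tail N c1) Rintegral_cst// mul1r.
  have -> : fine (P [set: Omega]) = 1 by rewrite probability_setT.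
  by under [in RHS]eq_bigr do rewrite mul1r.
have tB1 k : `|tail_from N (fun=> 1) k| <= 1 :> R.
  by rewrite /tail_from; case: ifP; rewrite ?normr1 ?normr0.
have tB k : `|tail_from N f k| <= B.
  by rewrite /tail_from; case: ifP => // _; rewrite normr0.
apply: le_trans (le_normr_Rintegral _ _) _ => //; first exact: integrable_nat_valued tB.
rewrite -RintegralZl//; last exact: integrable_nat_valued tB1.
apply: le_Rintegral => //.
- apply: (@integrable_nat_valued (fun k => `|tail_from N f k|) B) => k.
  by rewrite normr_id.
- apply: (@integrable_nat_valued (fun k => B * tail_from N (fun=> 1) k) B) => k.
  by rewrite normrM (ger0_norm B0) ler_piMr.
move=> w _; rewrite /tail_from; case: ifP => _; first by rewrite normr0 mulr0.
by rewrite mulr1.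
Qed.

End Truncation.

Lemma cvg_sum_probability_nat (mu : probability nat R) :
  \sum_(k < N) fine (mu [set k : nat]) @[N --> \oo] --> (1 : R).
Proof.
have := @measure_semi_sigma_additive _ _ _ mu (fun k => [set k]) (fun=> I).
have -> : \bigcup_k [set k] = [set: nat] by apply/seteqP; split=> // k _; exists k.
move=> /(_ _ I)/=; rewrite probability_setT => cv.
have /cv/fine_cvgP[_] : trivIset [set: nat] (fun k => [set k]).
  by move=> i j _ _ [k [/= -> ->]].
apply: cvg_trans; apply: near_eq_cvg; near=> N => /=.
by rewrite -sum_fine ?big_mkord// => k _; exact: fin_num_measure.
Unshelve. all: end_near. Qed.

(** Pointwise convergence of the point masses to a probability suffices, because
    no mass can escape: for fixed [N] the probability of the values from [N] on is
    one minus a finite sum of point masses, so it converges to its value for the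
    limit, which is small for large [N]. *)
Lemma cvg_in_distribution_pmf (d : nat -> measure_display)
    (Omega : forall n, measurableType (d n))
    (P : forall n, probability (Omega n) R)
    (X : forall n, Omega n -> nat) (mu : probability nat R) :
    (forall n k, measurable (X n @^-1` [set k])) ->
    (forall k, P n (X n @^-1` [set k]) @[n --> \oo] --> mu [set k]) ->
  cvg_in_distribution P X mu.
Proof.
move=> mX cvP f _ bf; have [B fB] : exists B : R, forall k, `|f k| <= B.
  by have [B _ /= fB] := pinfty_ex_gt0 bf; exists B => k; exact: fB.
have mid (k : nat) : measurable ((@id nat) @^-1` [set k]) by [].
pose E n := \int[P n]_w f (X n w); pose E0 := \int[mu]_k f k.
have -> : (fun n => 'E_(P n)[fun w => f (X n w)])%E = EFin \o E.
  apply/funext => n; rewrite unlock /E /Rintegral /= fineK//.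
  exact: integrable_fin_num (integrable_nat_valued (P n) (mX n) fB).
have -> : (\int[mu]_k (f k)%:E)%E = E0%:E.
  rewrite /E0 /Rintegral /= fineK//.
  exact: integrable_fin_num (integrable_nat_valued mu mid fB).
apply: cvg_EFin; first by near=> n.
rewrite (_ : fine \o (EFin \o E) = E)//.
pose p n k : R := fine (P n (X n @^-1` [set k])).
pose q k : R := fine (mu [set k]).
have cvp k : p n k @[n --> \oo] --> q k.
  have : P n (X n @^-1` [set k]) @[n --> \oo] --> (q k)%:E.
    by rewrite /q fineK ?fin_num_measure//; exact: cvP.
  by case/fine_cvgP.
apply/cvgrPdist_lt => e e0.
have [N tailN] : exists N, B * (1 - \sum_(k < N) q k) < e / 2.
  have : B * (1 - \sum_(k < N) q k) @[N --> \oo] --> B * (1 - 1).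
    apply: cvgMr; apply: cvgB; first exact: cvg_cst.
    exact: cvg_sum_probability_nat.
  rewrite subrr mulr0 => /cvgr_lt/(_ (e / 2)).
  rewrite divr_gt0// => /(_ isT)[N _ /(_ N (leqnn N))].
  by exists N.
have cvfp : \sum_(k < N) f k * p n k @[n --> \oo] --> \sum_(k < N) f k * q k.
  by apply: cvg_big => [|k _]; [exact: add_continuous|exact: cvgMr].
have cvp1 : \sum_(k < N) p n k @[n --> \oo] --> \sum_(k < N) q k.
  by apply: cvg_big => [|k _]; [exact: add_continuous|exact: cvp].
have cvbound : `|\sum_(k < N) f k * q k - \sum_(k < N) f k * p n k| +
    B * (1 - \sum_(k < N) p n k) @[n --> \oo] --> B * (1 - \sum_(k < N) q k).
  have cv1 : `|\sum_(k < N) f k * q k - \sum_(k < N) f k * p n k| @[n --> \oo] -->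
      `|\sum_(k < N) f k * q k - \sum_(k < N) f k * q k|.
    by apply: cvg_norm; apply: cvgB; [exact: cvg_cst|exact: cvfp].
  have cv2 : B * (1 - \sum_(k < N) p n k) @[n --> \oo] -->
      B * (1 - \sum_(k < N) q k).
    by apply: cvgMr; apply: cvgB; [exact: cvg_cst|exact: cvp1].
  by rewrite subrr normr0 in cv1; rewrite -[B * (1 - _)]add0r; exact: cvgD cv1 cv2.
near=> n.
have := expectation_truncation (P n) (mX n) N fB.
have := expectation_truncation mu mid N fB.
rewrite -/(E n) -/E0 => h0 hn.
have hb : `|\sum_(k < N) f k * q k - \sum_(k < N) f k * p n k| +
    B * (1 - \sum_(k < N) p n k) < e / 2.
  by near: n; exact: (cvgr_lt _ cvbound).
have -> : E0 - E n = (E0 - \sum_(k < N) f k * q k) +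
  (\sum_(k < N) f k * q k - \sum_(k < N) f k * p n k) -
  (E n - \sum_(k < N) f k * p n k) by ring.
apply: le_lt_trans (ler_normB _ _) _.
apply: le_lt_trans (lerD (ler_normD _ _) hn) _.
apply: le_lt_trans (lerD (lerD h0 (lexx _)) (lexx _)) _.
by rewrite -addrA [ltRHS]splitr ltrD.
Unshelve. all: end_near. Qed.

End DiscreteConvergence.

(** * The limit law *)

Section LimitLaw.
Variable R : realType.
Local Notation lebesgue := (@lebesgue_measure R).
Local Notation beta := (@beta_diag R).
Local Notation tail := (@tail_integral R).

Definition size_law m : R := m%:R * beta m + tail m.

Lemma size_law_ge0 m : 0 <= size_law m.
Proof.
have /andP[h0 _] := tail_integral_bound R m.
by rewrite addr_ge0// mulr_ge0// invr_ge0 mulr_ge0.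
Qed.

Lemma size_law_integral m :
  \int[lebesgue]_(x in `[0, 1])
    (m%:R * (x - x ^+ 2) ^+ m + x * (x - x ^+ 2) ^+ m / (1 - x + x ^+ 2)) =
  size_law m.
Proof.
have cu a : continuous (fun x : R => a * (x - x ^+ 2) ^+ m).
  rewrite (_ : (fun x => _) = horner (a *: parabola R ^+ m)).
    exact: continuous_horner.
  by apply/funext => x; rewrite hornerZ parabola_expE.
rewrite RintegralD//; last 2 first.
- exact/integrable01/cu.
- exact/integrable01/continuous_geometric_tail.
rewrite RintegralZl ?integral_beta//.
by apply: integrable01; have := cu 1; under eq_fun do rewrite mul1r.
Qed.

Lemma tail_integral_closed_form m : tail m = pi / (3 * Num.sqrt 3) -
  \sum_(j < m) (j.+1%:R * 'C(j.*2.+2, j.+1)%:R)^-1.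
Proof.
elim: m => [|m IHm]; first by rewrite big_ord0 subr0 tail_integral0.
rewrite big_ord_recr /= opprD addrA -IHm.
apply/eqP; rewrite eq_sym subr_eq addrC -subr_eq tail_integral_rec; apply/eqP.
have := mul_bin_diag m.*2.+2 m; rewrite /= -doubleS -muln2 => binE.
by rewrite /beta_diag -invfM -!natrM -binE mulnAC.
Qed.

Lemma size_law_closed_form m : size_law m =
  pi / (3 * Num.sqrt 3) + m%:R / (m.+1%:R * 'C(m.*2.+1, m)%:R) -
  \sum_(j < m) (j.+1%:R * 'C(j.*2.+2, j.+1)%:R)^-1.
Proof. by rewrite /size_law tail_integral_closed_form addrCA addrA. Qed.

(** The excess of the law for the caterpillar of parameter [n] over the limit law;
    it is the same for all sizes [m <= n]. *)
Definition size_excess n : R := beta n - tail n.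

Lemma size_excess_rec n : size_excess n - size_excess n.+1 =
  (n.+1%:R * 'C(n.+1.*2.+1, n.+1)%:R)^-1.
Proof.
have n1 : n.+1%:R != 0 :> R by rewrite pnatr_eq0.
have n2 : n.+2%:R != 0 :> R by rewrite pnatr_eq0.
have -> : (n.+1%:R * 'C(n.+1.*2.+1, n.+1)%:R)^-1 = n.+2%:R / n.+1%:R * beta n.+1.
  by rewrite /beta_diag !invfM mulrACA mulfV// mul1r.
have := tail_integral_rec R n; have := beta_diag_rec R n; rewrite /size_excess.
have -> : n.+2%:R = n%:R + 2 :> R by rewrite -addn2 natrD.
move: n1; have -> : n.+1%:R = n%:R + 1 :> R by rewrite -natr1.
move: n%:R (beta n) (beta n.+1) (tail n) (tail n.+1) => t b b' h h' t1 hb hh.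
have -> : b = (4 * t + 6) * b' / (t + 1) by rewrite hb mulrAC mulfV// mul1r.
have -> : h = h' + (4 * t + 6) * b' / (t + 1) / 2.
  by rewrite hb [_ * b]mulrC mulfK// -hh addrC subrK.
by field.
Qed.

(** For [n = m] the left-hand side is [(m + 1) * beta m], and by [size_excess_rec]
    both sides change by the same amount from [n] to [n + 1]. *)
Lemma finite_size_lawE n m : (m <= n)%N ->
  'C(m.*2.+1, m)%:R^-1 -
  \sum_(m.+1 <= k < n.+1) (k%:R * 'C(k.*2.+1, k)%:R)^-1 =
  size_law m + size_excess n.
Proof.
move=> mn; rewrite -(subnK mn); elim: (n - m)%N => [|j IHj].
  rewrite add0n big_geq// subr0 /size_law /size_excess.
  rewrite (_ : _ + (_ - _) = m.+1%:R * beta m); last by rewrite -natr1; ring.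
  by rewrite /beta_diag invfM mulrA mulfV ?pnatr_eq0// mul1r.
rewrite addSn big_nat_recr/=; last by rewrite ltnS leq_addl.
rewrite opprD addrA IHj.
by rewrite -size_excess_rec; ring.
Qed.

Lemma sum_size_law n :
  \sum_(m < n.+1) size_law m = 1 - n.+1%:R * size_excess n.
Proof.
elim: n => [|n IHn].
  rewrite big_ord1 /size_law /size_excess /beta_diag /= bin0 mul0r add0r !mul1r.
  by rewrite invr1 opprB addrC subrK.
rewrite big_ord_recr /= {}IHn.
have := tail_integral_rec R n; have := beta_diag_rec R n.
rewrite /size_law /size_excess.
have -> : n.+2%:R = n%:R + 2 :> R by rewrite -addn2 natrD.
have -> : n.+1%:R = n%:R + 1 :> R by rewrite -natr1.
move: n%:R (beta n) (beta n.+1) (tail n) (tail n.+1) => t b b' h h' hb hh.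
have -> : h = h' + b / 2 by rewrite -hh addrC subrK.
have -> : (t + 1) * (b - (h' + b / 2)) = (t + 1) * b / 2 - (t + 1) * h' by field.
by rewrite -hb; field.
Qed.

Lemma beta_diag_bound n : n.+1%:R ^+ 2 * beta n <= 1.
Proof.
elim: n => [|n]; first by rewrite /beta_diag /= bin0 expr1n !mul1r invr1.
apply: le_trans; have := beta_diag_rec R n.
have b0 : 0 <= beta n by rewrite invr_ge0 mulr_ge0.
have -> : n.+2%:R = n%:R + 2 :> R by rewrite -addn2 natrD.
have -> : n.+1%:R = n%:R + 1 :> R by rewrite -natr1.
have : 0 <= n%:R :> R by [].
move: n%:R (beta n) (beta n.+1) b0 => t b b' b0 t0 hb.
have t6 : 0 < 4 * t + 6 by rewrite ltr_wpDl// mulr_ge0.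
rewrite -(ler_pM2l t6) mulrCA hb.
have : 0 <= t * b by rewrite mulr_ge0.
have : 0 <= t * (t * b) by rewrite !mulr_ge0.
have : 0 <= t * (t * (t * b)) by rewrite !mulr_ge0.
by nra.
Qed.

(** As [tail n] lies between 0 and [2 * beta n], the excess is at most [beta n] in
    absolute value, and [beta n <= 1 / (n + 1) ^+ 2]. *)
Lemma cvg_size_excess : n.+1%:R * size_excess n @[n --> \oo] --> (0 : R).
Proof.
have bound n : `|n.+1%:R * size_excess n| <= harmonic n.
  have /andP[h0 h1] := tail_integral_bound R n; have b1 := beta_diag_bound n.
  have n0 : 0 < n.+1%:R :> R by rewrite ltr0n.
  rewrite normrM (gtr0_norm n0) /harmonic /= -div1r ler_pdivlMr//.
  apply: le_trans b1; rewrite mulrAC -expr2 ler_wpM2l ?exprn_ge0//.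
  by rewrite /size_excess ler_norml; apply/andP; split; lra.
apply/cvgr0Pnorm_lt => e e0; near=> n.
apply: le_lt_trans (bound n) _.
by near: n; exact: (cvgr_lt _ (@cvg_harmonic R)).
Unshelve. all: end_near. Qed.

Lemma cvg_size_excess0 : size_excess n @[n --> \oo] --> (0 : R).
Proof.
have cv : harmonic n * (n.+1%:R * size_excess n) @[n --> \oo] --> (0 : R).
  rewrite -(mulr0 (0 : R)); apply: cvgM; first exact: cvg_harmonic.
  exact: cvg_size_excess.
apply: cvg_trans cv; apply: near_eq_cvg; near=> n.
by rewrite /harmonic /= mulKf// pnatr_eq0.
Unshelve. all: end_near. Qed.

Lemma cvg_sum_size_law : \sum_(m < n) size_law m @[n --> \oo] --> (1 : R).
Proof.
rewrite -cvg_shiftS /=; under eq_cvg do rewrite sum_size_law.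
have : 1 - n.+1%:R * size_excess n @[n --> \oo] --> 1 - (0 : R).
  by apply: cvgB; [exact: cvg_cst|exact: cvg_size_excess].
by rewrite subr0.
Qed.

Definition size_measure : {measure set nat -> \bar R} :=
  mseries (fun k => mscale (NngNum (size_law_ge0 k)) (dirac k)
                    : {measure set nat -> \bar R}) 0.

Lemma size_measure1 m : size_measure [set m] = (size_law m)%:E.
Proof.
rewrite /size_measure /= /mseries.
rewrite (@nneseriesD1 _ _ m)//.
rewrite eseries0; last first.
  move=> k _ /= km; rewrite /mscale/= diracE memNset ?mule0// => /= kE.
  by rewrite kE eqxx in km.
rewrite adde0 -[LHS]/((size_law m)%:E * \d_m [set m])%E.
by rewrite diracE mem_set// mule1.
Qed.

Lemma size_measureT : size_measure setT = 1%E.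
Proof.
rewrite /size_measure /= /mseries /=.
rewrite [X in limn X](_ : _ = EFin \o (fun n => \sum_(m < n) size_law m)).
  apply/cvg_lim => //; apply: cvg_EFin; first by near=> n.
  exact: cvg_sum_size_law.
apply/funext => n /=; rewrite big_mkord -sumEFin; apply: eq_bigr => k _.
by rewrite -[LHS]/((size_law k)%:E * \d_(k : nat) setT)%E diracT mule1.
Unshelve. all: end_near. Qed.

Definition size_probability : probability nat R :=
  HB.pack (size_measure : set nat -> \bar R) (Measure.on size_measure)
    (Measure_isProbability.Build _ _ _ size_measure size_measureT).

End LimitLaw.

Theorem mainTheorem6 (R : realType) (d : nat -> measure_display)
    (Omega : forall n, measurableType (d n))
    (P : forall n, probability (Omega n) R)
    (C : forall n, cutting_process (caterpillar n) (P n)) :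
  exists mu : probability nat R,
    [/\ forall m : nat,
          P n [set w | #|separated_graph (chosen (C n)) w| = m]
            @[n --> \oo] --> mu [set m],
        forall m : nat,
          mu [set m] =
          (\int[lebesgue_measure]_(x in `[0, 1])
             (m%:R * (x - x ^+ 2) ^+ m +
              x * (x - x ^+ 2) ^+ m / (1 - x + x ^+ 2)) : R)%:E,
        forall m : nat,
          \int[lebesgue_measure]_(x in `[0, 1])
             (m%:R * (x - x ^+ 2) ^+ m +
              x * (x - x ^+ 2) ^+ m / (1 - x + x ^+ 2)) =
          pi / (3 * Num.sqrt 3)
          + m%:R / (m.+1%:R * 'C(m.*2.+1, m)%:R)
          - \sum_(j < m) (j.+1%:R * 'C(j.*2.+2, j.+1)%:R)^-1 :> R
      & cvg_in_distribution P
          (fun n w => #|separated_graph (chosen (C n)) w|) mu].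
Proof.
exists (size_probability R).
have cvP m : P n [set w | #|separated_graph (chosen (C n)) w| = m]
    @[n --> \oo] --> size_probability R [set m].
  rewrite [size_probability R _]size_measure1.
  have : size_law R m + size_excess R n @[n --> \oo] --> size_law R m + 0.
    by apply: cvgD; [exact: cvg_cst|exact: cvg_size_excess0].
  have finP n : P n [set w | #|separated_graph (chosen (C n)) w| = m] \is a fin_num.
    apply: fin_num_measure.
    have := measurable_separated_graph (C n) (fun S => #|S| == m).
    by congr measurable; apply/seteqP; split=> w /= /eqP.
  rewrite addr0 => cv; apply: cvg_EFin; first by near=> n.
  apply: cvg_trans cv; apply: near_eq_cvg; near=> n.
  have mn : (m <= n)%N by near: n; exact: nbhs_infty_ge.
  by rewrite /= final_size_law// finite_size_lawE.
split=> //.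
- by move=> m; rewrite [LHS]size_measure1 size_law_integral.
- by move=> m; rewrite size_law_integral size_law_closed_form.
- apply: cvg_in_distribution_pmf => // n k.
  have := measurable_separated_graph (C n) (fun S => #|S| == k).
  by congr measurable; apply/seteqP; split=> w /= /eqP.
Unshelve. all: end_near. Qed.
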